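(* Let $G$ be a finite group and let $\mathfrak{F}$ be a class of finite groups containing all identity (trivial) groups. (i) For any $G$-closed set $\Delta$ of chief factors of $G$, the set ${\cal L}_{\Delta}(G)$ is a sublattice of the lattice ${\cal L}(G)$ of all subgroups of $G$. (ii) If $\mathfrak{F}$ is a normally hereditary formation, then the set ${\cal L}_{\mathfrak{F}}(G)$ is a lattice (with respect to inclusion), namely a meet-sublattice of ${\cal L}(G)$. (iii) If $\mathfrak{F}$ is a Fitting formation, then ${\cal L}_{\mathfrak{F}}(G)$ is a sublattice of the lattice ${\cal L}(G)$.
   Context: All groups are finite; classes of groups are closed under isomorphism. ${\cal L}(G)$ is the lattice of all subgroups of $G$ (meet is $A\cap B$, join is $\langle A,B\rangle$). A sublattice of ${\cal L}(G)$ is a subset closed under both operations; a meet-sublattice is a subset that is a lattice under inclusion and in which the meet of two elements is their intersection. For $A\le G$: $A^{G}$ is the normal closure of $A$ in $G$ and $A_{G}=\bigcap_{x\in G}A^{x}$ is the core of $A$ in $G$. If $L\le T$ are normal subgroups of $G$, then $T/L$ is called a normal section of $G$. Two normal sections are $G$-isomorphic if there is an isomorphism between them commuting with the conjugation action of $G$. A chief factor of $G$ is a normal section $H/K$ such that $H/K$ is a minimal normal subgroup of $G/K$. A set $\Delta$ of normal sections of $G$ is $G$-closed if for any two $G$-isomorphic normal sections $H/K$ and $T/L$ of $G$ with $T/L\in\Delta$ we have $H/K\in\Delta$. For normal subgroups $L\le T$ of $G$ write $T/L\le Z_{\Delta}(G)$ if either $L=T$, or $L<T$ and $H/K\in\Delta$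 for every chief factor $H/K$ of $G$ with $L\le K<H\le T$. ${\cal L}_{\Delta}(G)$ is the set of all subgroups $A$ of $G$ such that $A^{G}/A_{G}\le Z_{\Delta}(G)$. ${\cal L}_{\mathfrak{F}}(G)$ is the set of all subgroups $A$ of $G$ such that $A^{G}/A_{G}\in\mathfrak{F}$. $G^{\mathfrak{F}}$ (the $\mathfrak{F}$-residual) is the intersection of all normal subgroups $N$ of $G$ with $G/N\in\mathfrak{F}$; $G_{\mathfrak{F}}$ (the $\mathfrak{F}$-radical) is the product of all normal subgroups $N$ of $G$ with $N\in\mathfrak{F}$. The class $\mathfrak{F}$ is: normally hereditary if $H\in\mathfrak{F}$ whenever $H\trianglelefteq G\in\mathfrak{F}$; a formation if for every group $G$ every homomorphic image of $G/G^{\mathfrak{F}}$ belongs to $\mathfrak{F}$; a Fitting class if for every group $G$ every normal subgroup of $G_{\mathfrak{F}}$ belongs to $\mathfrak{F}$; a Fitting formation if it is both a formation and a Fitting class. *)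

(* Defs.v *)
From HB Require Import structures.
From mathcomp Require Import all_boot all_fingroup all_solvable.
From mathcomp Require Import boolp.

Set Implicit Arguments.
Unset Strict Implicit.
Unset Printing Implicit Defensive.

Local Open Scope group_scope.

(* A section (T / L)%sec is the pair (T, L); it coerces to the quotient T / L. *)

Section NormalSections.

Variables (gT : finGroupType) (G : {group gT}).
Implicit Types (s t : section gT) (D : {set section gT}).

Definition normal_section s :=
  [&& s.1 <| G, s.2 <| G & s.2 \subset s.1].

Definition is_chief s := chief_factor G s.2 s.1.

(* chief_factor is phrased by maximality of s.2 below s.1; this is the same as
   s being a minimal normal subgroup of G / s.2. *)
Lemma is_chiefE s :
  is_chief s = normal_section s && minnormal (s.1 / s.2) (G / s.2).
Proof.
rewrite /is_chief /normal_section; apply/idP/idP => [ch | ].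
  have [maxK nsHG] := andP ch; have [pKH nKG] := andP (maxgroupp maxK).
  have sKH := proper_sub pKH.
  rewrite nsHG sKH (chief_factor_minnormal ch) /normal nKG.
  by rewrite (subset_trans sKH (normal_sub nsHG)).
case/andP=> /and3P[nsHG nsKG sKH] minH; rewrite /chief_factor nsHG andbT.
apply: minnormal_maxnormal minH; last exact: normal_norm.
exact: normalS sKH (normal_sub nsHG) nsKG.
Qed.

(* For normal sections, g in G acts on s.1 / s.2 as conjugation by its coset. *)
Definition G_isomorphic s t : Prop :=
  exists f : {morphism s.1 / s.2 >-> coset_of t.2},
    isom (s.1 / s.2) (t.1 / t.2) f /\
    {in G & s.1 / s.2, forall g x, f (x ^ coset s.2 g) = f x ^ coset t.2 g}.

Definition G_closed D : Prop :=
  forall s t, normal_section s -> normal_section t ->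
    G_isomorphic s t -> t \in D -> s \in D.

(* T / L <= Z_D(G) *)
Definition le_Z D (T L : {group gT}) : bool :=
  (L == T) ||
  (L \proper T) &&
  [forall s : section gT,
     [&& is_chief s, L \subset s.2, s.2 \proper s.1 & s.1 \subset T]
       ==> (s \in D)].

End NormalSections.

Definition normal_closure (gT : finGroupType) (A G : {group gT}) : {group gT} :=
  <<class_support A G>>%G.

Definition core (gT : finGroupType) (A G : {group gT}) : {group gT} :=
  [group of gcore A G].

Definition LDelta (gT : finGroupType) (G : {group gT})
    (D : {set section gT}) : {set {group gT}} :=
  [set A in subgroups G | le_Z G D (normal_closure A G) (core A G)].

Definition group_class := forall gT : finGroupType, {group gT} -> Prop.

Section Classes.

Variable F : group_class.

Definition isog_closed : Prop :=
  forall (gT rT : finGroupType) (G : {group gT}) (H : {group rT}),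
    G \isog H -> F G -> F H.

Definition contains_trivial : Prop := forall gT : finGroupType, F [1 gT]%G.

Definition residual (gT : finGroupType) (G : {group gT}) : {group gT} :=
  (\bigcap_(N : {group gT} | (N <| G) && `[< F (G / N)%G >]) N)%G.

Definition radical (gT : finGroupType) (G : {group gT}) : {group gT} :=
  (\prod_(N : {group gT} | (N <| G) && `[< F N >]) N)%G.

Definition normally_hereditary : Prop :=
  forall (gT : finGroupType) (G H : {group gT}), H <| G -> F G -> F H.

Definition formation : Prop :=
  forall (gT rT : finGroupType) (G : {group gT})
         (f : {morphism G / residual G >-> rT}),
    F (f @* (G / residual G))%G.

Definition Fitting_class : Prop :=
  forall (gT : finGroupType) (G H : {group gT}), H <| radical G -> F H.

Definition Fitting_formation : Prop := formation /\ Fitting_class.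

Definition LF (gT : finGroupType) (G : {group gT}) : {set {group gT}} :=
  [set A in subgroups G | `[< F (normal_closure A G / core A G)%G >]].

End Classes.

Section Lattices.

Variables (gT : finGroupType) (G : {group gT}).
Implicit Types (S : {set {group gT}}) (A B M J : {group gT}).

Definition sublattice S : Prop :=
  S \subset subgroups G /\
  {in S &, forall A B, (A :&: B)%G \in S /\ (A <*> B)%G \in S}.

Definition is_meet_in S A B M : Prop :=
  [/\ M \in S, M \subset A, M \subset B
    & {in S, forall C : {group gT}, C \subset A -> C \subset B -> C \subset M}].

Definition is_join_in S A B J : Prop :=
  [/\ J \in S, A \subset J, B \subset J
    & {in S, forall C : {group gT}, A \subset C -> B \subset C -> J \subset C}].

Definition lattice_under_inclusion S : Prop :=
  S != set0 /\
  {in S &, forall A B,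
     (exists M, is_meet_in S A B M) /\ (exists J, is_join_in S A B J)}.

Definition meet_sublattice S : Prop :=
  [/\ S \subset subgroups G, lattice_under_inclusion S
    & {in S &, forall A B, is_meet_in S A B (A :&: B)%G}].

End Lattices.

(* Main.v *)
Require Import Defs.
From mathcomp Require Import all_boot all_fingroup all_solvable.
From mathcomp Require Import boolp.

Set Implicit Arguments.
Unset Strict Implicit.
Unset Printing Implicit Defensive.

(** The subgroups in question are those A for which a relation P holds between
    the normal closure A^G and the core A_G, where P T L reads T / L <= Z_D(G)
    or T / L \in F.  Since A_G :&: B_G lies in the core of A :&: B, while the
    normal closure of A :&: B lies in A^G :&: B^G, closure of this set of
    subgroups under intersections follows from two properties of P on normal
    subgroups of G: P T L passes to smaller intervals (P T' L' whenever
    L \subset L' \subset T' \subset T), and P T L, P N M imply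
    P (T :&: N) (L :&: M).  Joins are dual, with P (T <*> N) (L <*> M).

    For P T L := T / L <= Z_D(G), chief factors are moved around by
    perspectivity (the second isomorphism theorem): for H, N normal in G, the sections
    H / (H :&: N) and H N / N are G-isomorphic, and one is a chief factor if and
    only if the other is.  This yields that P is transitive ([le_Z_trans]), and
    that P T L implies P (T :&: N) (L :&: N) and P (T N) (L N) ([le_Z_setI],
    [le_Z_joing]); the interval from L :&: M to T :&: N is then crossed in two
    steps, through L :&: N, and dually for joins.

    For P T L := T / L \in F with F a normally hereditary formation,
    (T :&: N) / (L :&: N) is isomorphic to a normal subgroup of T / L, and
    (T :&: N) / (T :&: M) to one of N / M; as (L :&: N) :&: (T :&: M) = L :&: M,
    the quotient (T :&: N) / (L :&: M) is a subdirect product of two groups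
    in F.
    For a Fitting formation, T N / L M is the product of two normal subgroups
    that are images of T / L and N / M, so it is its own F-radical.

    In the second assertion, joins come for free: a family of subgroups of G
    containing G and closed under intersections is a lattice. *)

Local Open Scope group_scope.

(** * Perspective normal sections *)

Section Perspective.

Variables (gT : finGroupType) (G : {group gT}).
Implicit Types (H K L M N T W : {group gT}) (s t : section gT).

Lemma is_chiefP H K :
  reflect [/\ H <| G, K <| G, K \proper H &
             forall W, W <| G -> K \subset W -> W \proper H -> W :=: K]
          (is_chief G (H / K)%sec).
Proof.
rewrite /is_chief /chief_factor /=; apply: (iffP idP) =>
  [/andP[/maxgroupP[/andP[pKH nKG] maxK] nsHG] | ].
  split=> // [|W /andP[_ nWG] sKW pWH]; last by apply: maxK; rewrite ?pWH.
  by rewrite /normal nKG (subset_trans (proper_sub pKH)) ?normal_sub.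
case=> nsHG nsKG pKH maxK; rewrite nsHG andbT.
apply/maxgroupP; split=> [|W /andP[pWH nWG] sKW].
  by rewrite pKH normal_norm.
apply: maxK => //; rewrite /normal nWG andbT.
exact: subset_trans (proper_sub pWH) (normal_sub nsHG).
Qed.

(** The modular law for normal subgroups, in terms of joins. *)
Lemma modular_normal H N W : N <| G -> W <| G -> H \subset W ->
  (H <*> N) :&: W = H <*> (N :&: W).
Proof.
move=> /andP[_ nNG] /andP[sWG nWG] sHW; have sHG := subset_trans sHW sWG.
rewrite (norm_joinEl (subset_trans sHG nNG)) -group_modl // norm_joinEl //.
by rewrite normsI ?(subset_trans sHG).
Qed.

(** The intervals from H :&: N to H and from N to H N in the lattice of normal
    subgroups are isomorphic, by modularity. *)
Lemma perspective_chief H N : H <| G -> N <| G ->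
  is_chief G (H / (H :&: N)%G)%sec = is_chief G ((H <*> N)%G / N)%sec.
Proof.
move=> nsHG nsNG; apply/is_chiefP/is_chiefP=> [] [_ _ pK maxK].
  split=> //; first exact: normalY.
    rewrite properE joing_subr; apply: contraL pK.
    rewrite join_subG => /andP[sHN _].
    by rewrite /= (setIidPl sHN) properxx.
  move=> W nsWG sNW pW.
  have sHWH: (H :&: W)%G \proper H.
    rewrite properE subsetIl; apply: contraL pW.
    rewrite subsetI => /andP[_ sHW].
    by rewrite properE negb_and negbK join_subG sHW sNW orbT.
  have eqHW: H :&: W = H :&: N.
    by apply: (maxK (H :&: W)%G); rewrite ?normalI ?setIS.
  have := modular_normal nsHG nsWG sNW.
  rewrite joingC (setIidPr (proper_sub pW)) eqHW => ->.
  by apply/joing_idPl; apply: subsetIr.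
split=> //; [exact: normalI | | ].
  rewrite properE subsetIl; apply: contraL pK; rewrite subsetI => /andP[_ sHN].
  by rewrite /= (joing_idPr sHN) properxx.
move=> W nsWG sKW pW; have sWH := proper_sub pW; apply/eqP.
rewrite eqEsubset sKW andbT /=.
rewrite subsetI (proper_sub pW) /=.
have sWN: (W <*> N)%G \proper (H <*> N)%G.
  rewrite properE genS ?setSU ?(proper_sub pW) //=.
  apply: contraL pW; rewrite join_subG => /andP[/= sHWN _].
  have := modular_normal nsNG nsHG sWH.
  rewrite (setIidPr sHWN) setIC (joing_idPl sKW) => ->.
  by rewrite properxx.
by rewrite -(maxK (W <*> N)%G) ?joing_subr ?normalY ?joing_subl.
Qed.

Lemma G_isomorphic_sym s t : normal_section G s ->
  G_isomorphic G s t -> G_isomorphic G t s.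
Proof.
case/and3P=> nsHG nsKG sKH [f [isof Jf]].
exists (isom_inv isof); split=> [|g y Gg Hy]; first exact: isom_sym.
have invE z : z \in s.1 / s.2 -> isom_inv isof (f z) = z.
  by move=> Sz; apply: (invmE (isom_inj isof)).
have: y \in f @* (s.1 / s.2) by rewrite (isom_im isof).
case/morphimP=> x _ Hx ->.
have Hxg: x ^ coset s.2 g \in s.1 / s.2.
  rewrite memJ_norm // (subsetP (quotient_norms _ (normal_norm nsHG))) //.
  by rewrite mem_quotient.
rewrite -Jf //; apply: etrans (invE _ Hxg) _.
by congr (_ ^ _); apply/esym/invE.
Qed.

(** The second isomorphism theorem, for G-isomorphisms. *)
Lemma perspective_G_isomorphic H N : H <| G -> N <| G ->
  G_isomorphic G (H / (H :&: N)%G)%sec ((H <*> N)%G / N)%sec.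
Proof.
move=> nsHG nsNG.
have nNH: H \subset 'N(N) := subset_trans (normal_sub nsHG) (normal_norm nsNG).
have [f0 inj0 im0] := second_isom nNH.
have eqK : (N :&: H)%G = (H :&: N)%G by apply/group_inj/setIC.
rewrite -eqK.
exists f0; split.
  apply/isomP; split=> //; rewrite im0 //= norm_joinEl //.
  by rewrite quotientMidr.
move=> g _ Gg /morphimP[x nx Hx ->].
(* second_isom describes f0 on images of subsets only; singletons give its
   values. *)
have fE y : y \in H -> f0 (coset (N :&: H) y) = coset N y.
  move=> Hy; have nKy: y \in 'N(N :&: H).
    exact: subsetP (normsI nNH (normG H)) y Hy.
  apply/set1_inj; rewrite -morphim_set1 ?mem_quotient //.
  by rewrite -quotient_set1 // im0 ?sub1set // quotient_set1 ?(subsetP nNH).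
have nKg : g \in 'N(N :&: H).
  by rewrite (subsetP (normsI (normal_norm nsNG) (normal_norm nsHG))).
have nNg : g \in 'N(N) by rewrite (subsetP (normal_norm nsNG)).
have Hxg: x ^ g \in H by rewrite memJ_norm // (subsetP (normal_norm nsHG)).
by rewrite /= -morphJ // !fE // morphJ // (subsetP nNH).
Qed.

Lemma perspective_mem (D : {set section gT}) H N :
    G_closed G D -> H <| G -> N <| G ->
  ((H / (H :&: N)%G)%sec \in D) = (((H <*> N)%G / N)%sec \in D).
Proof.
move=> clD nsHG nsNG; have iso := perspective_G_isomorphic nsHG nsNG.
have ns1: normal_section G (H / (H :&: N)%G)%sec.
  by rewrite /normal_section /= nsHG normalI ?subsetIl.
have ns2: normal_section G ((H <*> N)%G / N)%sec.
  by rewrite /normal_section /= nsNG normalY ?joing_subr.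
by apply/idP/idP; apply: clD => //; apply: G_isomorphic_sym.
Qed.

End Perspective.

(** * Intervals all of whose chief factors belong to D *)

Section Hypercentre.

Variables (gT : finGroupType) (G : {group gT}) (D : {set section gT}).
Hypothesis clD : G_closed G D.
Implicit Types (H K L M N T : {group gT}).

Lemma le_ZP T L : L \subset T ->
  reflect (forall H K, is_chief G (H / K)%sec -> L \subset K -> H \subset T ->
             (H / K)%sec \in D)
          (le_Z G D T L).
Proof.
move=> sLT; apply: (iffP orP) => [[/eqP-> | /andP[_ /forallP DZ]] | DZ].
- move=> H K /is_chiefP[_ _ /andP[_ /negP nKH] _] sTK sHT.
  by case: nKH; apply: subset_trans sHT sTK.
- move=> H K chHK sLK sHT; have [_ _ pKH _] := is_chiefP _ _ _ chHK.
  by have:= DZ (H / K)%sec; rewrite chHK sLK sHT pKH.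
case: eqP => [-> | /eqP neqLT]; [by left | right].
rewrite properEneq neqLT sLT; apply/forallP=> -[[H K]].
by apply/implyP=> /and4P[chHK sLK _ sHT]; apply: DZ.
Qed.

Lemma le_Z_sub T L T' L' : L \subset L' -> L' \subset T' -> T' \subset T ->
  le_Z G D T L -> le_Z G D T' L'.
Proof.
move=> sLL' sLT' sTT' /le_ZP DZ; apply/le_ZP=> // H K chHK sLK sHT.
have sLT: L \subset T by apply: subset_trans sLL' (subset_trans sLT' sTT').
exact: DZ sLT H K chHK (subset_trans sLL' sLK) (subset_trans sHT sTT').
Qed.

(** A chief factor H / K above L and below T is perspective to one below M
    if H = K (M :&: H), and to one above M otherwise. *)
Lemma le_Z_trans T M L : M <| G -> L \subset M -> M \subset T ->
  le_Z G D T M -> le_Z G D M L -> le_Z G D T L.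
Proof.
move=> nsMG sLM sMT /(le_ZP sMT) DTM /(le_ZP sLM) DML.
apply/(le_ZP (subset_trans sLM sMT)) => H K chHK sLK sHT.
have [nsHG nsKG pKH maxK] := is_chiefP _ _ _ chHK; have sKH := proper_sub pKH.
have mod: K <*> (M :&: H) = (K <*> M) :&: H.
  by rewrite (modular_normal nsMG nsHG).
have sH1: (K <*> (M :&: H))%G \subset H by rewrite /= mod subsetIr.
have [eqH | neH] := eqVneq (K <*> (M :&: H)) H.
  have eqH' : H = ((M :&: H)%G <*> K)%G.
    by apply/group_inj; rewrite /= joingC eqH.
  rewrite {1}eqH' -(perspective_mem clD) ?normalI //; apply: DML.
  - by rewrite perspective_chief ?normalI // -eqH'.
  - by rewrite !subsetI sLM sLK (subset_trans sLK).
  - exact: subsetIl.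
have eqK: (K <*> (M :&: H))%G = K.
  apply/group_inj/maxK; rewrite ?normalY ?normalI ?joing_subl //.
  by rewrite properEneq neH.
have eqK' : K = (H :&: (K <*> M))%G.
  by apply/group_inj; rewrite /= setIC -mod -{1}eqK.
have nsKM : (K <*> M)%G <| G by rewrite normalY.
rewrite eqK' (perspective_mem clD) //; apply: DTM.
- by rewrite -perspective_chief // -eqK'.
- exact: joing_subr.
- by rewrite !join_subG sHT sMT (subset_trans sKH).
Qed.

Lemma le_Z_setI T L N : T <| G -> L <| G -> N <| G -> L \subset T ->
  le_Z G D T L -> le_Z G D (T :&: N) (L :&: N).
Proof.
move=> nsTG nsLG nsNG sLT /(le_ZP sLT) DTL.
apply/le_ZP => [|H K chHK]; first exact: setSI.
rewrite !subsetI => sLNK /andP[sHT sHN].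
have [nsHG nsKG pKH _] := is_chiefP _ _ _ chHK; have sKH := proper_sub pKH.
have nsKL : (K <*> L)%G <| G by rewrite normalY.
have eqK: K = (H :&: (K <*> L))%G.
  apply/group_inj; rewrite /= setIC (modular_normal nsLG nsHG sKH).
  by apply/esym/joing_idPl; apply: subset_trans (setIS L sHN) sLNK.
rewrite eqK (perspective_mem clD) //; apply: DTL.
- by rewrite -perspective_chief // -eqK.
- exact: joing_subr.
- by rewrite !join_subG sHT sLT (subset_trans sKH).
Qed.

Lemma le_Z_joing T L N : T <| G -> L <| G -> N <| G -> L \subset T ->
  le_Z G D T L -> le_Z G D (T <*> N) (L <*> N).
Proof.
move=> nsTG nsLG nsNG sLT /(le_ZP sLT) DTL.
apply/le_ZP => [|H K chHK]; first exact: genS (setSU _ _).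
rewrite !join_subG => /andP[sLK sNK] sHTN.
have [nsHG nsKG pKH _] := is_chiefP _ _ _ chHK; have sKH := proper_sub pKH.
have eqH: H = ((T :&: H)%G <*> K)%G.
  apply/group_inj/eqP; rewrite eqEsubset join_subG subsetIr sKH !andbT /=.
  have:= modular_normal nsTG nsHG (subset_trans sNK sKH).
  rewrite joingC (setIidPr sHTN) => {1}->; rewrite joingC.
  exact: genS (setUS _ _).
rewrite {1}eqH -(perspective_mem clD) ?normalI //; apply: DTL.
- by rewrite perspective_chief ?normalI // -eqH.
- by rewrite !subsetI sLT sLK (subset_trans sLK).
- exact: subsetIl.
Qed.

Lemma le_Z_setI2 T L N M : T <| G -> L <| G -> N <| G -> M <| G ->
    L \subset T -> M \subset N -> le_Z G D T L -> le_Z G D N M ->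
  le_Z G D (T :&: N) (L :&: M).
Proof.
move=> nsTG nsLG nsNG nsMG sLT sMN DTL DNM.
apply: (@le_Z_trans _ (L :&: N)%G); rewrite ?normalI ?setIS ?setSI //.
  exact: le_Z_setI.
have:= le_Z_setI nsNG nsMG nsLG sMN DNM.
by congr (le_Z _ _ _ _); apply/group_inj/setIC.
Qed.

Lemma le_Z_joing2 T L N M : T <| G -> L <| G -> N <| G -> M <| G ->
    L \subset T -> M \subset N -> le_Z G D T L -> le_Z G D N M ->
  le_Z G D (T <*> N) (L <*> M).
Proof.
move=> nsTG nsLG nsNG nsMG sLT sMN DTL DNM.
apply: (@le_Z_trans _ (L <*> N)%G); rewrite ?normalY ?genS ?setUS ?setSU //.
  exact: le_Z_joing.
have:= le_Z_joing nsNG nsMG nsLG sMN DNM.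
by congr (le_Z _ _ _ _); apply/group_inj/joingC.
Qed.

End Hypercentre.

(** * Normally hereditary formations *)

Section Formations.

Variable F : group_class.
Hypotheses (F_isog : isog_closed F) (F_form : formation F).

Lemma residual_sub (gT : finGroupType) (G N : {group gT}) :
  N <| G -> F (G / N)%G -> residual F G \subset N.
Proof.
by move=> nsNG FGN; apply: (bigcap_inf N); rewrite nsNG; apply/asboolP.
Qed.

Lemma residual_normal (gT : finGroupType) (G : {group gT}) :
  contains_trivial F -> residual F G <| G.
Proof.
move=> F1; apply/andP; split.
  apply: residual_sub => //; apply: F_isog (F1 gT).
  by rewrite /= trivg_quotient; apply: trivial_isog.
by apply: norms_bigcap; apply/bigcapsP=> N /andP[/normal_norm].
Qed.

Hypothesis F_triv : contains_trivial F.

(** The quotients of G by the normal subgroups containing the residual are the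
    homomorphic images of G / G^F. *)
Lemma formation_residual (gT : finGroupType) (G N : {group gT}) :
  N <| G -> residual F G \subset N -> F (G / N)%G.
Proof.
move=> nsNG sRN; have nsRG := residual_normal G F_triv.
have sGN : G / residual F G \subset 'N(N / residual F G).
  by rewrite quotient_norms ?normal_norm.
have := F_form [morphism of restrm sGN (coset (N / residual F G))].
apply: F_isog; rewrite /= morphim_restrm setIid.
exact: third_isog.
Qed.

Lemma formation_quotient (gT : finGroupType) (G N : {group gT}) :
  N <| G -> F G -> F (G / N)%G.
Proof.
move=> nsNG FG; apply: formation_residual => //.
apply: subset_trans (sub1G N); apply: (@residual_sub _ _ 1%G (normal1 G)).
exact: F_isog (quotient1_isog G) FG.
Qed.

(** A formation is closed under subdirect products. *)
Lemma formation_subdirect (gT : finGroupType) (G N M : {group gT}) :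
  N <| G -> M <| G -> F (G / N)%G -> F (G / M)%G -> F (G / (N :&: M))%G.
Proof.
move=> nsNG nsMG FN FM; apply: (@formation_residual _ G (N :&: M)%G).
  exact: normalI.
by rewrite subsetI !residual_sub.
Qed.

Lemma formation_quotientS (gT : finGroupType) (G T L L' : {group gT}) :
    L <| G -> L' <| G -> L \subset L' -> T \subset G -> L' \subset T ->
  F (T / L)%G -> F (T / L')%G.
Proof.
move=> nsLG nsL'G sLL' sTG sL'T FTL.
have nsLT: L <| T := normalS (subset_trans sLL' sL'T) sTG nsLG.
have nsL'T: L' <| T := normalS sL'T sTG nsL'G.
apply: F_isog (third_isog sLL' nsLT nsL'T) _.
by apply: (@formation_quotient _ (T / L)%G (L' / L)%G);
  rewrite ?quotient_normal.
Qed.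

(** When N contains L, the quotient T / N, which stands for T N / N, is an
    image of T / L. *)
Lemma formation_quotient_joing (gT : finGroupType) (G T L N : {group gT}) :
    T <| G -> L <| G -> N <| G -> L \subset N -> L \subset T -> F (T / L)%G ->
  F (T / N)%G.
Proof.
move=> nsTG nsLG nsNG sLN sLT FTL.
have nNT: T \subset 'N(N) := subset_trans (normal_sub nsTG) (normal_norm nsNG).
apply: F_isog (second_isog nNT) _.
apply: (@formation_quotientS _ G T L (N :&: T)%G) => //.
- exact: normalI.
- by rewrite subsetI sLN.
- exact: normal_sub.
- exact: subsetIr.
Qed.

Hypothesis F_hered : normally_hereditary F.

Lemma formation_section (gT : finGroupType) (G T L T' L' : {group gT}) :
    T <| G -> L <| G -> T' <| G -> L' <| G ->
    L \subset L' -> L' \subset T' -> T' \subset T ->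
  F (T / L)%G -> F (T' / L')%G.
Proof.
move=> nsTG nsLG nsT'G nsL'G sLL' sLT' sTT' FTL.
apply: (formation_quotientS nsLG nsL'G sLL' (normal_sub nsT'G) sLT').
apply: F_hered FTL; apply: quotient_normal.
exact: normalS sTT' (normal_sub nsTG) nsT'G.
Qed.

Lemma formation_sectionI (gT : finGroupType) (G T L N : {group gT}) :
    T <| G -> L <| G -> N <| G -> L \subset T ->
  F (T / L)%G -> F ((T :&: N) / (L :&: N))%G.
Proof.
move=> nsTG nsLG nsNG sLT FTL.
have nsI : T :&: N <| G by apply: normalI.
have nLI: (T :&: N)%G \subset 'N(L) :=
  subset_trans (normal_sub nsI) (normal_norm nsLG).
have -> : L :&: N = L :&: (T :&: N)%G by rewrite /= setIA (setIidPl sLT).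
apply: F_isog (isog_symr (second_isog nLI)) _; apply: F_hered FTL.
apply: quotient_normal; apply: normalS (subsetIl _ _) (normal_sub nsTG) nsI.
Qed.

Lemma formation_setI2 (gT : finGroupType) (G T L N M : {group gT}) :
    T <| G -> L <| G -> N <| G -> M <| G -> L \subset T -> M \subset N ->
  F (T / L)%G -> F (N / M)%G -> F ((T :&: N) / (L :&: M))%G.
Proof.
move=> nsTG nsLG nsNG nsMG sLT sMN FTL FNM.
have nsTN : (T :&: N)%G <| G by apply: normalI.
have nsI (K : {group gT}) : K <| G -> K \subset (T :&: N)%G -> K <| (T :&: N)%G.
  by move=> nsKG sKI; apply: normalS sKI (normal_sub nsTN) nsKG.
have FM : F ((T :&: N)%G / (T :&: M)%G)%G.
  have := formation_sectionI nsNG nsMG nsTG sMN FNM.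
  have -> : (N :&: T)%G = (T :&: N)%G by apply/group_inj/setIC.
  by have -> : M :&: T = (T :&: M)%G by apply: setIC.
have := @formation_subdirect _ (T :&: N)%G (L :&: N)%G (T :&: M)%G.
have eqLM : L :&: N :&: (T :&: M) = L :&: M.
  by rewrite setIACA (setIidPl sLT) (setIidPr sMN).
rewrite /= eqLM; apply; rewrite ?nsI ?normalI ?setIS ?setSI //.
exact: (formation_sectionI nsTG nsLG nsNG).
Qed.

End Formations.

(** * Fitting formations *)

Section Fitting.

Variable F : group_class.
Hypothesis F_Fit : Fitting_class F.

Lemma radical_sup (gT : finGroupType) (G N : {group gT}) :
  N <| G -> F N -> N \subset radical F G.
Proof.
move=> nsNG FN; rewrite /radical bigprodGE sub_gen //.
by apply: (bigcup_sup N); rewrite // nsNG; apply/asboolP.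
Qed.

Lemma radical_sub (gT : finGroupType) (G : {group gT}) : radical F G \subset G.
Proof.
rewrite /radical bigprodGE gen_subG.
by apply/bigcupsP=> N /andP[/normal_sub].
Qed.

(** A group in F is its own F-radical. *)
Lemma Fitting_normally_hereditary : normally_hereditary F.
Proof.
move=> gT G H nsHG FG; apply: (F_Fit (G := G)).
suff ->: radical F G = G by [].
by apply/group_inj/eqP; rewrite eqEsubset radical_sub radical_sup.
Qed.

Lemma Fitting_joing (gT : finGroupType) (N M : {group gT}) :
  N <| N <*> M -> M <| N <*> M -> F N -> F M -> F (N <*> M)%G.
Proof.
move=> nsN nsM FN FM; apply: (F_Fit (G := (N <*> M)%G)).
suff ->: radical F (N <*> M)%G = (N <*> M)%G by [].
apply/group_inj/eqP; rewrite eqEsubset radical_sub join_subG.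
by rewrite !radical_sup.
Qed.

Lemma Fitting_formation_joing2 (gT : finGroupType) (G T L N M : {group gT}) :
    isog_closed F -> contains_trivial F -> formation F ->
    T <| G -> L <| G -> N <| G -> M <| G -> L \subset T -> M \subset N ->
  F (T / L)%G -> F (N / M)%G -> F ((T <*> N) / (L <*> M))%G.
Proof.
move=> F_isog F1 F_form nsTG nsLG nsNG nsMG sLT sMN FTL FNM.
have nsLM : (L <*> M)%G <| G by apply: normalY.
have nLM K : K <| G -> K \subset 'N(L <*> M).
  by move=> nsKG; apply: subset_trans (normal_sub nsKG) (normal_norm nsLM).
have FT: F (T / (L <*> M)%G)%G.
  apply: (formation_quotient_joing F_isog F_form F1 nsTG nsLG nsLM) => //.
  exact: joing_subl.
have FN: F (N / (L <*> M)%G)%G.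
  apply: (formation_quotient_joing F_isog F_form F1 nsNG nsMG nsLM) => //.
  exact: joing_subr.
have eqQ: ((T <*> N) / (L <*> M))%G = ((T / (L <*> M)) <*> (N / (L <*> M)))%G.
  by apply/group_inj; rewrite /= quotientY ?nLM.
rewrite eqQ; have nsQ (K : {group gT}) : K <| G ->
    K / (L <*> M) <| G / (L <*> M) by apply: quotient_normal.
have sQ : (T / (L <*> M)) <*> (N / (L <*> M)) \subset G / (L <*> M).
  by rewrite join_subG !quotientS ?normal_sub.
by apply: Fitting_joing => //; apply: normalS sQ _;
  rewrite ?nsQ ?joing_subl ?joing_subr.
Qed.

End Fitting.

(** * Normal closures and cores *)

Section ClosureCore.

Variables (gT : finGroupType) (G : {group gT}).
Implicit Types A B N : {group gT}.

Lemma normal_closure_sub A : A \subset normal_closure A G.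
Proof. exact: sub_gen (sub_class_support _ _). Qed.

Lemma normal_closure_normal A : A \subset G -> normal_closure A G <| G.
Proof.
move=> sAG; rewrite /normal gen_subG class_support_subG //.
by rewrite norms_gen ?class_support_norm.
Qed.

Lemma normal_closure_min A N :
  N <| G -> A \subset N -> normal_closure A G \subset N.
Proof.
by move=> /normal_norm nNG sAN; rewrite gen_subG class_support_sub_norm.
Qed.

Lemma core_normal A : A \subset G -> core A G <| G.
Proof. exact: gcore_normal. Qed.

Lemma core_sub A : core A G \subset A.
Proof. exact: gcore_sub. Qed.

Lemma core_max A N : N <| G -> N \subset A -> N \subset core A G.
Proof. by move=> /normal_norm nNG sNA; apply: gcore_max. Qed.

Lemma core_sub_closure A : core A G \subset normal_closure A G.
Proof. exact: subset_trans (core_sub A) (normal_closure_sub A). Qed.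

(** A relation between normal subgroups T, L of G, to be read as a property of
    the section T / L. *)
Variable P : {group gT} -> {group gT} -> Prop.
Hypothesis P_sub : forall T L T' L' : {group gT},
  T <| G -> L <| G -> T' <| G -> L' <| G ->
  L \subset L' -> L' \subset T' -> T' \subset T -> P T L -> P T' L'.

Let PA A := P (normal_closure A G) (core A G).

Lemma closure_core_setI A B :
    (forall T L N M : {group gT}, T <| G -> L <| G -> N <| G -> M <| G ->
       L \subset T -> M \subset N -> P T L -> P N M ->
       P (T :&: N)%G (L :&: M)%G) ->
  A \subset G -> B \subset G -> PA A -> PA B -> PA (A :&: B)%G.
Proof.
move=> PI sAG sBG PAA PAB.
have sIG : (A :&: B)%G \subset G by rewrite subIset ?sAG.
have nsT := normal_closure_normal; have nsL := core_normal.
have PTN := PI _ _ _ _ (nsT _ sAG) (nsL _ sAG) (nsT _ sBG) (nsL _ sBG)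
  (core_sub_closure A) (core_sub_closure B) PAA PAB.
apply: P_sub PTN; rewrite ?normalI ?nsT ?nsL ?core_sub_closure //.
  by rewrite core_max ?normalI ?nsL ?setISS ?core_sub.
by rewrite normal_closure_min ?normalI ?nsT ?setISS ?normal_closure_sub.
Qed.

Lemma closure_core_joing A B :
    (forall T L N M : {group gT}, T <| G -> L <| G -> N <| G -> M <| G ->
       L \subset T -> M \subset N -> P T L -> P N M ->
       P (T <*> N)%G (L <*> M)%G) ->
  A \subset G -> B \subset G -> PA A -> PA B -> PA (A <*> B)%G.
Proof.
move=> PJ sAG sBG PAA PAB.
have sJG : (A <*> B)%G \subset G by rewrite join_subG sAG.
have nsT := normal_closure_normal; have nsL := core_normal.
have PTN := PJ _ _ _ _ (nsT _ sAG) (nsL _ sAG) (nsT _ sBG) (nsL _ sBG)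
  (core_sub_closure A) (core_sub_closure B) PAA PAB.
apply: P_sub PTN; rewrite ?normalY ?nsT ?nsL ?core_sub_closure //.
  by rewrite core_max ?normalY ?nsL ?genS ?setUSS ?core_sub.
by rewrite normal_closure_min ?normalY ?nsT ?genS ?setUSS ?normal_closure_sub.
Qed.

End ClosureCore.

(** A family containing the top element and closed under meets is a lattice. *)
Lemma meet_sublattice_setI (gT : finGroupType) (G : {group gT})
    (S : {set {group gT}}) :
    S \subset subgroups G -> G \in S ->
    {in S &, forall A B, (A :&: B)%G \in S} ->
  meet_sublattice G S.
Proof.
move=> sSG GS SI.
have meetI: {in S &, forall A B, is_meet_in S A B (A :&: B)%G}.
  move=> A B SA SB; split; [exact: SI | exact: subsetIl | exact: subsetIr |].
  by move=> C _ sCA sCB; rewrite subsetI sCA.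
split=> //; split; first by apply/set0Pn; exists G.
move=> A B SA SB; split; first by exists (A :&: B)%G; apply: meetI.
pose U (C : {group gT}) := [&& C \in S, A \subset C & B \subset C].
have UG: U G.
  have:= subsetP sSG A SA; have:= subsetP sSG B SB.
  by rewrite /U GS !inE => -> ->.
(* The join is a minimal member J of S above A and B: intersecting J with any
   other such member gives J back. *)
have [J /mingroupP[/and3P[SJ sAJ sBJ] minJ] _] := mingroup_exists (gP := U) UG.
exists J; split=> // C SC sAC sBC.
have UJC : U (J :&: C)%G by rewrite /U SI // !subsetI sAJ sAC sBJ.
by rewrite -(minJ _ UJC (subsetIl J C)) subsetIr.
Qed.

Theorem theorem1p1 (gT : finGroupType) (G : {group gT}) (F : group_class)
    (F_isog : isog_closed F) (F_triv : contains_trivial F) :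
  [/\ (forall D : {set section gT},
         (forall s : section gT, s \in D -> is_chief G s) ->
         G_closed G D -> sublattice G (LDelta G D)),
      (normally_hereditary F -> formation F -> meet_sublattice G (LF F G))
    & (Fitting_formation F -> sublattice G (LF F G))].
Proof.
have LFI : normally_hereditary F -> formation F ->
    {in LF F G &, forall A B, (A :&: B)%G \in LF F G}.
  move=> F_hered F_form A B; rewrite !inE.
  move=> /andP[sAG /asboolP FA] /andP[sBG /asboolP FB].
  rewrite subIset ?sAG //; apply/asboolP.
  apply: (closure_core_setI (P := fun T L => F _ (T / L)%G) _ _ sAG sBG FA FB).
    by move=> T L T' L'; apply: formation_section.
  by move=> T L N M; apply: formation_setI2.
have sLF : LF F G \subset subgroups G.
  by apply/subsetP=> A; rewrite inE => /andP[].
split=> [D _ clD | F_hered F_form | [F_form F_Fit]].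
- split=> [|A B]; first by apply/subsetP=> A; rewrite inE => /andP[].
  rewrite !inE => /andP[sAG ZA] /andP[sBG ZB].
  rewrite subIset ?sAG // join_subG sAG sBG /=; split.
    apply: (closure_core_setI (P := le_Z G D) _ _ sAG sBG ZA ZB).
      by move=> T L T' L' _ _ _ _; apply: le_Z_sub.
    by move=> T L N M; apply: le_Z_setI2.
  apply: (closure_core_joing (P := le_Z G D) _ _ sAG sBG ZA ZB).
    by move=> T L T' L' _ _ _ _; apply: le_Z_sub.
  by move=> T L N M; apply: le_Z_joing2.
- apply: meet_sublattice_setI (LFI F_hered F_form) => //.
  rewrite !inE subxx; apply/asboolP.
  have -> : core G G = G.
    by apply/group_inj/eqP; rewrite eqEsubset core_sub core_max.
  have -> : normal_closure G G = G.
    apply/group_inj/eqP.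
    by rewrite eqEsubset normal_closure_sub normal_closure_min.
  apply: F_isog (F_triv gT).
  by rewrite /= trivg_quotient; apply: trivial_isog.
have F_hered := Fitting_normally_hereditary F_Fit.
split=> // A B LA LB; split; first exact: LFI.
move: LA LB; rewrite !inE => /andP[sAG /asboolP FA] /andP[sBG /asboolP FB].
rewrite join_subG sAG sBG; apply/asboolP.
apply: (closure_core_joing (P := fun T L => F _ (T / L)%G) _ _ sAG sBG FA FB).
  by move=> T L T' L'; apply: formation_section.
by move=> T L N M; apply: Fitting_formation_joing2.
Qed.
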